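(* Let $n \geq 0$ be an integer. Let $A(n)$ be the total number of parts, counted with multiplicity, in all partitions of $n$ all of whose parts are congruent to $\pm 1 \pmod 5$, and let $B(n)$ be the total number of parts in all super-distinct partitions of $n$. Then $A(n) - B(n)$ equals the number of pairs $(\lambda, (a^b))$ of partitions such that $a \geq 1$ and $b \geq 1$ are integers, $\lambda$ is a super-distinct partition of $n - ab$, $a \equiv \pm 1 \pmod 5$, and, if $a = 1$, then at least one of $b-1$, $b$, $b+1$ is a part of $\lambda$.
   Context: A partition of $n$ is a non-increasing sequence of positive integers (parts) summing to $n$; the empty partition is the unique partition of $0$. A partition is super-distinct if any two of its parts differ by at least $2$; the empty partition is considered super-distinct. For positive integers $a,b$, $(a^b)$ denotes the partition consisting of $b$ parts equal to $a$, so the pair $(\lambda,(a^b))$ has total size $|\lambda|+ab$. Pairs are counted as ordered pairs of partitions, i.e. distinct pairs $(\lambda,(a^b))$ are counted separately. *)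

(* Defs.v *)
From HB Require Import structures.
From mathcomp Require Import all_boot all_order all_algebra.

Set Implicit Arguments.
Unset Strict Implicit.
Unset Printing Implicit Defensive.

Import IntDist.

Definition is_part (n : nat) (s : seq nat) : bool :=
  [&& sorted geq s, all (ltn 0) s & sumn s == n].

Record intpart (n : nat) :=
  IntPart { parts :> seq nat; partsP : is_part n parts }.

HB.instance Definition _ n := [isSub for @parts n].
HB.instance Definition _ n := [Countable of intpart n by <:].

Lemma size_le_sumn (s : seq nat) : all (ltn 0) s -> size s <= sumn s.
Proof.
elim: s => //= x s IHs /andP[x_gt0 /IHs le_s].
by rewrite -add1n leq_add.
Qed.

Lemma mem_le_sumn (s : seq nat) x : x \in s -> x <= sumn s.
Proof.
elim: s => //= y s IHs; rewrite inE => /predU1P[->|/IHs le_x].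
  exact: leq_addr.
exact: leq_trans le_x (leq_addl _ _).
Qed.

Definition intpart_encode n (p : intpart n) : option (n.-bseq 'I_n.+1) :=
  insub (map inord p).

Definition intpart_decode n (o : option (n.-bseq 'I_n.+1)) :
    option (intpart n) :=
  obind (fun s : n.-bseq 'I_n.+1 => insub (map val s)) o.

Lemma intpart_encodeK n : pcancel (@intpart_encode n) (@intpart_decode n).
Proof.
move=> p; have /and3P[_ p_gt0 /eqP sum_p] := partsP p.
rewrite /intpart_encode insubT ?size_map -?{2}sum_p ?size_le_sumn // => sz.
rewrite /= -map_comp -[RHS]valK; congr insub.
rewrite -[RHS]map_id; apply/eq_in_map => x xp /=.
by rewrite inordK // ltnS -sum_p mem_le_sumn.
Qed.

HB.instance Definition _ n : isFinite (intpart n) :=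
  PCanIsFinite (@intpart_encodeK n).

Definition pm1_mod5 (a : nat) : bool :=
  (a == 1 %[mod 5]) || (a == 4 %[mod 5]).

(* [pairwise] ranges over positions, so a repeated part is excluded. *)
Definition super_distinct (s : seq nat) : bool :=
  pairwise (fun x y : nat => 2 <= `|x - y|) s.

Definition A (n : nat) : nat :=
  \sum_(p : intpart n | all pm1_mod5 p) size p.

Definition B (n : nat) : nat :=
  \sum_(p : intpart n | super_distinct p) size p.

(* The ordered pairs (lambda, mu) of partitions with |lambda| + |mu| = n,
   tagged by m = |mu|. *)
Definition part_pair (n : nat) : finType :=
  {m : 'I_n.+1 & (intpart (n - m) * intpart m)%type}.

(* Bounding a and b by n loses nothing: a * b = |mu| <= n and a, b >= 1;
   see [pair_setP].  When b = 1, b.-1 = 0 is never a part. *)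
Definition pair_set (n : nat) : {set part_pair n} :=
  [set p : part_pair n |
    let: (lambda, mu) := tagged p in
    [exists a : 'I_n.+1, exists b : 'I_n.+1,
      [&& 1 <= a, 1 <= b, parts mu == nseq b (a : nat),
          super_distinct lambda, pm1_mod5 a
        & ((a : nat) == 1) ==>
          [|| b.-1 \in parts lambda, (b : nat) \in parts lambda
            | b.+1 \in parts lambda]]]].

Lemma pair_setP n (m : 'I_n.+1) (lambda : intpart (n - m)) (mu : intpart m) :
  reflect
    (exists a b : nat,
      [/\ 1 <= a /\ 1 <= b, parts mu = nseq b a, super_distinct lambda,
          pm1_mod5 a
        & a = 1 -> [\/ b.-1 \in parts lambda, b \in parts lambda
                     | b.+1 \in parts lambda]])
    (Tagged (fun m : 'I_n.+1 => (intpart (n - m) * intpart m)%type)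
            (lambda, mu) \in pair_set n).
Proof.
rewrite inE /=; apply: (iffP existsP) => [[a /existsP[b]]|[a [b]]].
  case/and5P=> a1 b1 /eqP def_mu sd /andP[a5 /implyP ab].
  by exists a, b; split=> // /eqP/ab/or3P.
case=> -[a1 b1] def_mu sd a5 ab.
have /and3P[_ _ /eqP] := partsP mu; rewrite def_mu sumn_nseq => def_m.
have le_ab : a * b <= n by rewrite def_m -ltnS.
have a_lt : a < n.+1 by rewrite ltnS (leq_trans _ le_ab) // leq_pmulr.
have b_lt : b < n.+1 by rewrite ltnS (leq_trans _ le_ab) // leq_pmull.
exists (Ordinal a_lt); apply/existsP; exists (Ordinal b_lt) => /=.
rewrite a1 b1 eqxx sd a5 /=.
by apply/implyP => /eqP/ab/or3P.
Qed.

(* Main.v *)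
Require Import Defs.
From mathcomp Require Import all_boot all_order all_algebra qpoly zify ring.

(* Listing the multiplicities of the parts shows that A n counts the pairs
   (mu, (a^b)) with a and all parts of mu congruent to 1 or 4 mod 5.  By the
   first Rogers-Ramanujan identity mu may be replaced by a super-distinct
   lambda.  The pairs with a = 1 and none of b-1, b, b+1 in lambda correspond to
   super-distinct partitions of n with a distinguished part b (insert b into
   lambda), so there are B n of them.

   The Rogers-Ramanujan identity is obtained from Schur's polynomials: the
   generating function E_N of super-distinct partitions with parts < N satisfies
   E_(N+2) = E_(N+1) + q^(N+1) E_N, and so does
   \sum_j (-1)^j q^(j(5j+1)/2) [N; floor((N-5j)/2)], by a telescoping argument.
   As N grows, this becomes \sum_j (-1)^j q^(j(5j+1)/2) / (q)_oo, whose
   numerator is \prod_k (1-q^(5k+2))(1-q^(5k+3))(1-q^(5k+5)) by a finite form of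
   Jacobi's triple product. *)

Set Implicit Arguments.
Unset Strict Implicit.
Unset Printing Implicit Defensive.

Import Order.TTheory GRing.Theory Num.Theory IntDist.

(** * Counting partitions *)

Definition npart (n : nat) (P : pred (seq nat)) : nat :=
  #|[pred p : intpart n | P (parts p)]|.

Lemma npartE n P : npart n P = \sum_(p : intpart n) P (parts p).
Proof. by rewrite /npart -sum1_card big_mkcond. Qed.

Lemma eq_in_npart n (P Q : pred (seq nat)) :
  (forall s, is_part n s -> P s = Q s) -> npart n P = npart n Q.
Proof. by move=> PQ; apply: eq_card => p; rewrite !inE PQ ?partsP. Qed.

Lemma npart_split n (P Q : pred (seq nat)) :
  npart n P =
  npart n (fun s => P s && ~~ Q s) + npart n (fun s => P s && Q s).
Proof.
rewrite !npartE -big_split; apply: eq_bigr => p _ /=.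
by case: (P p); case: (Q p).
Qed.

Lemma perm_intpart_eq n (p p' : intpart n) :
  perm_eq (parts p) (parts p') -> p = p'.
Proof.
move=> pp'; apply: val_inj; have /and3P[s1 _ _] := partsP p.
have /and3P[s2 _ _] := partsP p'; apply: (sorted_eq _ _ s1 s2 pp').
  by move=> x y z; rewrite /geq /= => ? ?; lia.
by move=> x y; rewrite /geq /= => ?; lia.
Qed.

Lemma is_part_add a n s : 0 < a -> is_part n s ->
  is_part (a + n) (sort geq (a :: s)).
Proof.
move=> a_gt0 /and3P[_ s_gt0 /eqP <-]; apply/and3P; split.
- by apply: sort_sorted => x y; rewrite /geq /=; lia.
- by rewrite all_sort /= a_gt0.
- by rewrite (perm_sumn (permEl (perm_sort _ _))).
Qed.

Lemma is_part_rem a n s : a \in s -> is_part (a + n) s -> is_part n (rem a s).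
Proof.
move=> sa /and3P[s_sorted s_gt0 sum_s]; apply/and3P; split.
- apply: (subseq_sorted _ (rem_subseq a s)) => //.
  by move=> x y z; rewrite /geq /= => ? ?; lia.
- by apply/allP => x /mem_rem; apply: (allP s_gt0).
- by move: sum_s; rewrite (perm_sumn (perm_to_rem sa)) /= eqn_add2l.
Qed.

(** Inserting [a] and re-sorting is inverse to deleting one occurrence of [a]; the invariance of [Q]
    under permutation absorbs the sorting. *)
Lemma npart_rem a n (Q : pred (seq nat)) : 0 < a ->
  (forall s t, perm_eq s t -> Q s = Q t) ->
  npart (a + n) (fun s => (a \in s) && Q (rem a s)) = npart n Q.
Proof.
move=> a_gt0 Qperm.
pose h (p : intpart n) := IntPart (is_part_add a_gt0 (partsP p)).
have hP (p : intpart n) : perm_eq (parts (h p)) (a :: parts p).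
  by rewrite perm_sort.
have h_inj : injective h.
  move=> p p' eqh; apply: perm_intpart_eq.
  by rewrite -(perm_cons a) -(permPl (hP p)) eqh hP.
rewrite /npart -(card_image h_inj); apply: eq_card => p; rewrite !inE /=.
apply/andP/imageP => [[pa Qp]|[p' Qp' ->]].
  exists (IntPart (is_part_rem pa (partsP p))) => //.
  apply: perm_intpart_eq.
  by rewrite perm_sym (permPl (hP _)) perm_sym perm_to_rem.
have ha : a \in parts (h p') by rewrite (perm_mem (hP p')) mem_head.
split=> //; rewrite (Qperm _ (parts p')) // -(perm_cons a).
by rewrite -(permPl (perm_to_rem ha)).
Qed.

(** The common source of [nsd_lt_rec], [npm1_lt_rec], [npart_count] and [B_sum]: [Q] is the
    condition that [P] leaves on the other parts once one copy of [a] is removed. *)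
Lemma npart_mem a n (P Q : pred (seq nat)) : 0 < a ->
  (forall s t, perm_eq s t -> P s = P t) ->
  (forall s t, perm_eq s t -> Q s = Q t) ->
  (forall s, P (a :: s) = Q s) ->
  npart n (fun s => P s && (a \in s)) =
  if a <= n then npart (n - a) Q else 0.
Proof.
move=> a_gt0 Pperm Qperm PQ; case: leqP => [lean|ltna].
  rewrite -(@npart_rem a (n - a) Q) // subnKC //; apply: eq_in_npart => s _.
  rewrite andbC; case: (boolP (a \in s)) => //= sa.
  by rewrite (Pperm _ _ (perm_to_rem sa)).
rewrite npartE big1 // => p _.
case: (boolP (a \in _)) => [/mem_le_sumn|]; rewrite ?andbF //.
by have /and3P[_ _ /eqP->] := partsP p; lia.
Qed.

Lemma super_distinct_cons x s :
  super_distinct (x :: s) =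
  all (fun y : nat => 2 <= `|x - y|) s && super_distinct s.
Proof. by []. Qed.

(** [pairwise] compares earlier entries with later ones only, so it is the symmetry of the distance
    that permits reordering. *)
Lemma super_distinct_perm s t :
  perm_eq s t -> super_distinct s = super_distinct t.
Proof.
wlog suff imp : s t / perm_eq s t -> super_distinct s -> super_distinct t.
  by move=> st; apply/idP/idP; apply: imp; rewrite // perm_sym.
elim: s t => [|x s IHs] t st.
  by move: st; rewrite perm_sym => /perm_nilP ->.
rewrite super_distinct_cons => /andP[xs sd].
have tx : x \in t by rewrite -(perm_mem st) mem_head.
have [t1 [t2 def_t]] : exists t1 t2, t = t1 ++ x :: t2.
  by case/splitPr: tx => t1 t2; exists t1, t2.
have st12 : perm_eq s (t1 ++ t2).
  by rewrite -(perm_cons x) (permPl st) def_t -cat1s perm_catCA.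
move: xs (IHs _ st12 sd); rewrite (perm_all _ st12) def_t /super_distinct.
rewrite !pairwise_cat allrel_consr pairwise_cons all_cat.
case/andP=> x1 -> /and3P[-> -> ->]; rewrite !andbT /=.
by apply: sub_all x1 => y; rewrite distnC.
Qed.

Definition npm1 n := npart n (all pm1_mod5).
Definition nsd n := npart n super_distinct.

Lemma part_le n s x : is_part n s -> x \in s -> 0 < x <= n.
Proof.
case/and3P=> _ /allP s_gt0 /eqP <- sx.
by rewrite mem_le_sumn // andbT; apply: s_gt0.
Qed.

Lemma all_lt_part n N s : n < N -> is_part n s -> all (gtn N) s.
Proof.
move=> ltnN sP; apply/allP => x /(part_le sP) /andP[_ lexn].
by apply: leq_ltn_trans ltnN.
Qed.

Lemma all_ltS N (s : seq nat) :
  all (gtn N.+1) s && (N \notin s) = all (gtn N) s.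
Proof.
elim: s => //= x s <-; rewrite inE negb_or ltnS leq_eqVlt [N == x]eq_sym.
by case: eqVneq => //= [->|_]; rewrite ?ltnn ?andbF //; case: ltnP => //=.
Qed.

Definition nsd_lt N n := npart n (fun s => super_distinct s && all (gtn N) s).

(** Either [N.+1] is not a part, or removing it leaves parts below [N], since they are at distance
    at least 2 from it. *)
Lemma nsd_lt_rec N n :
  nsd_lt N.+2 n =
  nsd_lt N.+1 n + if N.+1 <= n then nsd_lt N (n - N.+1) else 0.
Proof.
rewrite /nsd_lt (npart_split _ _ (fun s => N.+1 \in s)); congr addn.
  by apply: eq_in_npart => s _; rewrite -andbA all_ltS.
apply: npart_mem => // [s t st|s t st|s].
- by rewrite (super_distinct_perm st) (perm_all _ st).
- by rewrite (super_distinct_perm st) (perm_all _ st).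
rewrite super_distinct_cons /= ltnSn /= andbAC andbC; congr andb.
rewrite -all_predI; apply: eq_all => x /=; lia.
Qed.

Definition npm1_lt N n := npart n (fun s => all pm1_mod5 s && all (gtn N) s).

(** Here the removed part [N] may occur again, so the second term keeps the bound [N.+1]. *)
Lemma npm1_lt_rec N n : 0 < N ->
  npm1_lt N.+1 n =
  npm1_lt N n + if pm1_mod5 N && (N <= n) then npm1_lt N.+1 (n - N) else 0.
Proof.
move=> N_gt0; rewrite /npm1_lt (npart_split _ _ (fun s => N \in s)); congr addn.
  by apply: eq_in_npart => s _; rewrite -andbA all_ltS.
case: (boolP (pm1_mod5 N)) => /= [N5|N5].
  apply: npart_mem => // [s t st|s t st|s]; rewrite ?(perm_all _ st) //.
  by rewrite /= N5 ltnSn.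
rewrite npartE big1 // => p _.
case: (boolP (N \in _)) => [pN|]; last by rewrite andbF.
by case: allP => // /(_ _ pN); rewrite (negPf N5).
Qed.

Lemma npart_lt1 n N (P : pred (seq nat)) : N <= 1 ->
  P [::] -> npart n (fun s => P s && all (gtn N) s) = (n == 0).
Proof.
move=> leN1 P0.
have nilP s : is_part n s -> all (gtn N) s -> s = [::].
  case: s => //= x s /and3P[_ /andP[x_gt0 _] _] /andP[ltxN _].
  by have := leq_trans ltxN leN1; rewrite ltnS leqNgt (x_gt0 : 0 < x).
case: eqVneq => [n0|n_neq0].
  have nil0 : is_part n [::] by rewrite n0.
  apply: (@eq_card1 _ (IntPart nil0)) => p; rewrite !inE -val_eqE /=.
  apply/andP/eqP => [[_ /(nilP _ (partsP p))] //|-> //].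
rewrite npartE big1 // => p _; case: allP => [pN|_]; last by rewrite andbF.
have p0 : parts p = [::] by apply: nilP (partsP p) _; apply/allP.
by have := partsP p; rewrite p0 /is_part /= eq_sym (negPf n_neq0).
Qed.

(** * Double sums for [A], [B] and the pairs *)

Lemma size_count n s : is_part n s ->
  size s = \sum_(a < n.+1 | 0 < a) count_mem (a : nat) s.
Proof.
move=> /part_le; elim: s => [|x s IHs] s_le /=; first by rewrite big1.
rewrite big_split /= -IHs => [|y sy]; last by apply: s_le; rewrite inE sy orbT.
have /andP[x_gt0 lexn] := s_le x (mem_head _ _).
rewrite (bigD1 (Ordinal (lexn : x < n.+1))) //= eqxx big1 // => a /andP[_].
by rewrite -val_eqE /= eq_sym => /negPf->.
Qed.

(** Applied to a multiplicity [c], this provides the index [b] of the pair (a^b). *)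
Lemma sum_leq_ord c n : c <= n -> \sum_(b < n.+1 | 0 < b) (b <= c) = c.
Proof.
rewrite big_mkcond big_ord_recl /= add0n => lecn.
transitivity (minn n c); last by lia.
elim: n {lecn} => [|n IHn]; first by rewrite big_ord0 min0n.
by rewrite big_ord_recr IHn /= /bump; lia.
Qed.

Lemma npart_count a b n : 0 < a -> pm1_mod5 a ->
  npart n (fun s => all pm1_mod5 s && (b <= count_mem a s)) =
  if a * b <= n then npm1 (n - a * b) else 0.
Proof.
move=> a_gt0 a5; elim: b n => [|b IHb] n.
  by rewrite muln0 subn0; apply: eq_in_npart => s _; rewrite andbT.
(* Membership of [a] follows from its positive multiplicity; it is added so that [npart_mem] can
   strip one copy. *)
transitivity
  (npart n (fun s => (all pm1_mod5 s && (b < count_mem a s)) && (a \in s))).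
  apply: eq_in_npart => s _; rewrite -has_pred1 has_count.
  by case: (all _ _) => //=; lia.
rewrite (@npart_mem a n _ (fun s => all pm1_mod5 s && (b <= count_mem a s))) //.
- rewrite IHb mulnS; case: leqP => lean; last by case: leqP; lia.
  have -> : n - a - a * b = n - (a + a * b) by lia.
  by have -> : (a * b <= n - a) = (a + a * b <= n) by lia.
- by move=> s t st; rewrite (perm_all _ st) (permP st).
- by move=> s t st; rewrite (perm_all _ st) (permP st).
by move=> s; rewrite /= a5 eqxx add1n ltnS.
Qed.

Lemma npart_count0 a b n : 0 < b -> ~~ pm1_mod5 a ->
  npart n (fun s => all pm1_mod5 s && (b <= count_mem a s)) = 0.
Proof.
move=> b_gt0 a5; rewrite npartE big1 // => p _.
case: allP => //= p5; case: leqP => // lebc; have := leq_trans b_gt0 lebc.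
by rewrite -has_count has_pred1 => /p5; rewrite (negPf a5).
Qed.

(** A part [a] of multiplicity [c] is counted once for each [b] from 1 to [c]; removing [b] copies
    of [a] leaves the other partition of the pair. *)
Lemma A_sum n : A n =
  \sum_(a < n.+1 | 0 < a) \sum_(b < n.+1 | 0 < b)
    if pm1_mod5 a && (a * b <= n) then npm1 (n - a * b) else 0.
Proof.
transitivity
  (\sum_(p : intpart n) \sum_(a < n.+1 | 0 < a) \sum_(b < n.+1 | 0 < b)
    (all pm1_mod5 p && (b <= count_mem (a : nat) p)) : nat).
  rewrite /A big_mkcond; apply: eq_bigr => p _ /=; case: ifP => p5 /=.
    rewrite (size_count (partsP p)); apply: eq_bigr => a _.
    rewrite sum_leq_ord // (leq_trans (count_size _ _)) //.
    have /and3P[_ p_gt0 /eqP {2}<-] := partsP p; exact: size_le_sumn.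
  by rewrite big1 // => a _; rewrite big1.
rewrite exchange_big; apply: eq_bigr => a a_gt0 /=.
rewrite exchange_big; apply: eq_bigr => b b_gt0 /=.
rewrite -(npartE n (fun s => all pm1_mod5 s && (b <= count_mem (a : nat) s))).
case: (boolP (pm1_mod5 a)) => a5 /=; first exact: npart_count.
exact: npart_count0.
Qed.

Definition near (b : nat) (s : seq nat) :=
  [|| b.-1 \in s, b \in s | b.+1 \in s].

Lemma super_distinct_near b s : 0 < b ->
  super_distinct (b :: s) = super_distinct s && ~~ near b s.
Proof.
move=> b_gt0; rewrite super_distinct_cons andbC; congr andb.
elim: s => //= x s ->; rewrite /near !inE !negb_or.
case: (b.-1 \in s); case: (b \in s); case: (b.+1 \in s);
  rewrite ?andbF ?andbT //=; lia.
Qed.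

(** Parts of a super-distinct partition do not repeat, so its size counts the [b] that occur in it.
    Removing [b] is reversible exactly when [b] is not [near] the rest. *)
Lemma B_sum n : B n =
  \sum_(b < n.+1 | 0 < b)
    npart (n - b) (fun s => super_distinct s && ~~ near b s).
Proof.
transitivity (\sum_(p : intpart n) \sum_(b < n.+1 | 0 < b)
    (super_distinct p && ((b : nat) \in parts p)) : nat).
  rewrite /B big_mkcond; apply: eq_bigr => p _ /=; case: ifP => sdp /=.
    rewrite (size_count (partsP p)); apply: eq_bigr => b _.
    rewrite count_uniq_mem // (pairwise_uniq _ sdp) // => x.
    by rewrite distnn.
  by rewrite big1.
rewrite exchange_big; apply: eq_bigr => b b_gt0 /=.
rewrite -(npartE n (fun s => super_distinct s && ((b : nat) \in s))).
rewrite (@npart_mem b n super_distinct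
  (fun s => super_distinct s && ~~ near b s)) //.
- by rewrite -ltnS ltn_ord.
- exact: super_distinct_perm.
- by move=> s t st; rewrite (super_distinct_perm st) /near !(perm_mem st).
- by move=> s; rewrite super_distinct_near.
Qed.

(** Since [nseq b a] determines positive [a] and [b], the existential in [pair_set] becomes a sum,
    which can be exchanged with the sums over partitions. *)
Lemma exists2_sum (I J : finType) (C : I -> J -> bool) :
  (forall i j i' j', C i j -> C i' j' -> i = i' /\ j = j') ->
  [exists i, exists j, C i j] = \sum_i \sum_j C i j :> nat.
Proof.
move=> C_uniq; rewrite pair_big /=.
have -> : \sum_p C p.1 p.2 = #|[pred p | C p.1 p.2]|.
  by rewrite -sum1_card [RHS]big_mkcond.
have : #|[pred p | C p.1 p.2]| <= 1.
  apply/card_le1_eqP => -[i j] [i' j']; rewrite !inE /= => Cij Cij'.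
  by have [-> ->] := C_uniq _ _ _ _ Cij Cij'.
case: existsP => [[i /existsP[j Cij]] card_le1|no_ij _].
  by apply/eqP; rewrite eqn_leq card_le1 andbT; apply/card_gt0P; exists (i, j).
apply/esym/eqP; rewrite -leqn0 leqNgt; apply/card_gt0P => -[[i j]].
by rewrite inE => Cij; case: no_ij; exists i; apply/existsP; exists j.
Qed.

Lemma sum_nseq_part a b m : 0 < a ->
  \sum_(mu : intpart m) (parts mu == nseq b a) = (m == a * b).
Proof.
move=> a_gt0; case: eqVneq => [m_ab|m_neq]; last first.
  rewrite big1 // => mu _; apply/eqP; rewrite eqb0; apply/negP => /eqP mu_ab.
  have /and3P[_ _] := partsP mu.
  by rewrite mu_ab sumn_nseq eq_sym (negPf m_neq).
have nseq_part : is_part m (nseq b a).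
  rewrite /is_part all_nseq /= a_gt0 orbT sumn_nseq m_ab eqxx andbT.
  by elim: b {m_ab} => [|[|b] IHb] //=; rewrite /geq /= leqnn.
rewrite (bigD1 (IntPart nseq_part)) //= eqxx big1 // => mu.
by rewrite -val_eqE /= => /negPf->.
Qed.

Lemma card_pair_set n : #|pair_set n| =
  \sum_(a < n.+1 | 0 < a) \sum_(b < n.+1 | 0 < b)
    if pm1_mod5 a && (a * b <= n)
    then npart (n - a * b)
      (fun s => super_distinct s && ((a == 1 :> nat) ==> near b s))
    else 0.
Proof.
pose C (l mu : seq nat) (a b : nat) :=
  [&& 1 <= a, 1 <= b, mu == nseq b a,
      super_distinct l, pm1_mod5 a & (a == 1) ==> near b l].
transitivity (\sum_(m < n.+1) \sum_(l : intpart (n - m)) \sum_(mu : intpart m)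
  \sum_(a < n.+1) \sum_(b < n.+1) (C l mu a b : nat)).
  transitivity (\sum_(m < n.+1) \sum_(x : intpart (n - m) * intpart m)
    (Tagged (fun m : 'I_n.+1 => (intpart (n - m) * intpart m)%type) x
       \in pair_set n)).
    by rewrite sig_big_dep -sum1_card big_mkcond; apply: eq_bigr => -[m x] _.
  apply: eq_bigr => m _; rewrite pair_big; apply: eq_bigr => -[l mu] _ /=.
  rewrite inE /= -exists2_sum // => a b a' b'.
  case/and3P=> a_gt0 b_gt0 /andP[/eqP-> _] /and4P[_ _ /eqP eq_nseq _].
  have eqb : b = b' :> nat by have := congr1 size eq_nseq; rewrite !size_nseq.
  (* As [b] is positive, the head of [nseq b a] is [a] and not the default 0. *)
  split; apply: val_inj => //; have := congr1 (head 0) eq_nseq.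
  by rewrite /= -eqb; case: (val b) b_gt0.
(* With the sums over [a] and [b] outermost, only [m = a * b] and [mu = nseq b a] survive in the
   inner ones. *)
transitivity (\sum_(a < n.+1) \sum_(b < n.+1) \sum_(m < n.+1)
  \sum_(l : intpart (n - m)) \sum_(mu : intpart m) (C l mu a b : nat)).
  under eq_bigr => m _.
    under eq_bigr => l _ do rewrite exchange_big.
    rewrite exchange_big; over.
  rewrite exchange_big; apply: eq_bigr => a _.
  under eq_bigr => m _.
    under eq_bigr => l _ do rewrite exchange_big.
    rewrite exchange_big; over.
  by rewrite exchange_big.
rewrite [RHS]big_mkcond; apply: eq_bigr => a _; case: posnP => [a0|a_gt0].
  rewrite big1 // => b _; rewrite big1 // => m _; rewrite big1 // => l _.
  by rewrite big1 // => mu _; rewrite /C a0.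
rewrite [RHS]big_mkcond; apply: eq_bigr => b _; case: posnP => [b0|b_gt0].
  rewrite big1 // => m _; rewrite big1 // => l _.
  by rewrite big1 // => mu _; rewrite /C b0 andbF.
pose D (l : seq nat) :=
  [&& super_distinct l, pm1_mod5 a & (a == 1 :> nat) ==> near b l].
transitivity (\sum_(m < n.+1) (m == a * b :> nat) * npart (n - m) D).
  apply: eq_bigr => m _; rewrite npartE big_distrr; apply: eq_bigr => l _ /=.
  rewrite -sum_nseq_part // big_distrl; apply: eq_bigr => mu _ /=.
  by rewrite /C a_gt0 b_gt0 /= mulnb.
case: (leqP (a * b) n) => [le_ab|lt_ab]; last first.
  rewrite andbF big1 // => m _; case: eqP => // m_ab.
  by have := ltn_ord m; rewrite m_ab ltnS leqNgt lt_ab.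
rewrite (bigD1 (Ordinal (le_ab : a * b < n.+1))) //= eqxx mul1n big1 ?addn0.
  rewrite andbT; case: (boolP (pm1_mod5 a)) => a5.
    by apply: eq_in_npart => s _; rewrite /D a5.
  by rewrite npartE big1 // => p _; rewrite /D (negPf a5) andbF.
by move=> m; rewrite -val_eqE /= => /negPf->.
Qed.

Local Open Scope ring_scope.

(** * Gaussian binomials and finite theta series *)

Section QBinomial.
Variables (R : comNzRingType) (q : R).

Fixpoint qbin (n k : nat) : R :=
  match n, k with
  | _, 0%N => 1
  | 0%N, _.+1 => 0
  | n'.+1, k'.+1 => qbin n' k' + q ^+ k * qbin n' k
  end.

Lemma qbin0 n : qbin n 0 = 1. Proof. by case: n. Qed.

Lemma qbinS n k : qbin n.+1 k.+1 = qbin n k + q ^+ k.+1 * qbin n k.+1.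
Proof. by []. Qed.

Lemma qbin_small n k : (n < k)%N -> qbin n k = 0.
Proof.
elim: n k => [|n IHn] [|k] //= ltnk.
by rewrite !IHn ?mulr0 ?addr0 // ltnW.
Qed.

(** The ratio of neighbouring Gaussian binomials without division; it yields the second Pascal rule
    [qbinS'] and the factorial formula [qbin_fact]. *)
Lemma qbin_step n k : (k <= n)%N ->
  (1 - q ^+ (n - k)) * qbin n k = (1 - q ^+ k.+1) * qbin n k.+1.
Proof.
elim: n k => [|n IHn] [|k] // lekn.
- by rewrite subrr mul0r qbin_small ?mulr0.
- rewrite qbinS !qbin0 subn0 mulr1.
  have := IHn 0%N (leq0n _); rewrite subn0 qbin0 mulr1 => E.
  rewrite mulrDr mulr1 mulrCA -E exprS; ring.
rewrite subSS !qbinS mulrDr [RHS]mulrDr.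
rewrite (mulrCA _ (q ^+ k.+1)) (mulrCA _ (q ^+ k.+2)).
rewrite ltnS in lekn; rewrite IHn //.
case: (ltnP k n) => [ltkn|lenk].
  rewrite -(IHn _ ltkn) -(subnSK ltkn) !(exprS q); ring.
have -> : k = n by apply/eqP; rewrite eqn_leq lekn.
by rewrite !(@qbin_small n) //; ring.
Qed.

Lemma qbinS' n k : (k <= n)%N ->
  qbin n.+1 k.+1 = q ^+ (n - k) * qbin n k + qbin n k.+1.
Proof.
move=> lekn; rewrite qbinS.
transitivity (q ^+ (n - k) * qbin n k + (1 - q ^+ (n - k)) * qbin n k
  + q ^+ k.+1 * qbin n k.+1); first by ring.
by rewrite qbin_step //; ring.
Qed.

Definition qfact (n : nat) : R := \prod_(i < n) (1 - q ^+ i.+1).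

Lemma qfactS n : qfact n.+1 = qfact n * (1 - q ^+ n.+1).
Proof. exact: big_ord_recr. Qed.

Lemma qbin_fact n k : (k <= n)%N ->
  qbin n k * (qfact k * qfact (n - k)) = qfact n.
Proof.
elim: n k => [|n IHn] [|k] //= lekn; rewrite /= ?subn0.
- by rewrite /qfact !big_ord0 !mulr1.
- by rewrite /qfact big_ord0 !mul1r.
rewrite ltnS in lekn; rewrite subSS.
case: (ltnP k n) => [ltkn|lenk].
  have E1 := IHn _ lekn; have E2 := IHn _ ltkn.
  rewrite (qfactS n) -[X in _ = X * _]E1.
  have -> : qfact (n - k) = qfact (n - k.+1) * (1 - q ^+ (n - k)).
    by rewrite -(subnSK ltkn) qfactS.
  have -> : q ^+ n.+1 = q ^+ k.+1 * q ^+ (n - k).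
    by rewrite -exprD; congr (_ ^+ _); lia.
  have E := qbin_step lekn.
  rewrite qfactS; move: (q ^+ k.+1) (q ^+ (n - k)) E => x y E.
  rewrite mulrDl.
  suff -> : x * qbin n k.+1 * (qfact k * (1 - x) * (qfact (n - k.+1) * (1 - y)))
    = x * ((1 - x) * qbin n k.+1) * (qfact k * (qfact (n - k.+1) * (1 - y))).
    by rewrite -E; ring.
  by ring.
have -> : k = n by apply/eqP; rewrite eqn_leq lekn.
rewrite (@qbin_small n n.+1) // subnn mulr0 addr0 qfactS.
by rewrite -[in RHS](IHn n) // subnn; ring.
Qed.

(** Extension by zero makes both Pascal rules valid at every integer index. *)
Definition qbinz (n : nat) (k : int) : R :=
  if k is Posz k' then qbin n k' else 0.

Lemma qbinz_out n (k : int) : ~ (0 <= k <= n%:Z) -> qbinz n k = 0.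
Proof. by case: k => //= k hk; rewrite qbin_small //; lia. Qed.

Lemma qbinzS n (k : int) :
  qbinz n.+1 k = qbinz n (k - 1) + q ^+ `|k| * qbinz n k.
Proof.
case: k => [[|k]|k]; last by rewrite /= mulr0 addr0.
  by rewrite /= !qbin0 mulr1 add0r.
by have -> : k.+1%:Z - 1 = k by lia.
Qed.

Lemma qbinzS' n (k : int) :
  qbinz n.+1 k = q ^+ `|n.+1%:Z - k| * qbinz n (k - 1) + qbinz n k.
Proof.
case: k => [[|k]|k]; last by rewrite /= mulr0 addr0.
  by rewrite /= !qbin0 mulr0 add0r.
have -> : k.+1%:Z - 1 = k by lia.
have [lekn|ltnk] := leqP k n; last first.
  by rewrite /qbinz !qbin_small ?mulr0 ?addr0 //; lia.
have -> : `|(n.+1%:Z - k.+1%:Z)%R|%N = (n - k)%N by lia.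
exact: qbinS'.
Qed.

(* The exponents met below are absolute values of integers; they are the
   intended ones only where the coefficient does not vanish. *)
Lemma qbinz_exp (x : R) n (k : int) a b :
  (0 <= k <= n%:Z -> a = b) -> x ^+ a * qbinz n k = x ^+ b * qbinz n k.
Proof.
move=> eqab; case: (boolP (0 <= k <= n%:Z)) => [/eqab-> //|/negP out].
by rewrite qbinz_out // !mulr0.
Qed.

End QBinomial.

(** * Sums over symmetric integer ranges *)

Section IntSum.
Variable R : comNzRingType.

Definition zsum (L : nat) (f : int -> R) : R :=
  \sum_(0 <= i < L.*2.+1) f (i%:Z - L%:Z).

Lemma eq_zsum L f g : f =1 g -> zsum L f = zsum L g.
Proof. by move=> fg; apply: eq_bigr => i _; rewrite fg. Qed.

Lemma zsumD L f g : zsum L (fun j => f j + g j) = zsum L f + zsum L g.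
Proof. exact: big_split. Qed.

Lemma zsumZ L c f : zsum L (fun j => c * f j) = c * zsum L f.
Proof. by rewrite /zsum mulr_sumr. Qed.

Lemma zsum_telescope L (f : int -> R) :
  zsum L (fun j => f j - f (j + 1)) = f (- L%:Z) - f (L%:Z + 1).
Proof.
have E : forall n, \sum_(0 <= i < n) (f (i%:Z - L%:Z) - f (i%:Z - L%:Z + 1)) =
    f (- L%:Z) - f (n%:Z - L%:Z).
  elim=> [|n IHn]; first by rewrite big_nil sub0r subrr.
  rewrite big_nat_recr //= IHn.
  by have -> : n%:Z - L%:Z + 1 = n.+1%:Z - L%:Z; [lia | ring].
by rewrite /zsum E; congr (_ - f _); lia.
Qed.

Lemma zsum_shift L (f : int -> R) :
  f (- L%:Z) = 0 -> f (L%:Z + 1) = 0 -> zsum L (fun j => f (j + 1)) = zsum L f.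
Proof.
move=> f0 f1; apply/eqP; rewrite eq_sym -subr_eq0 -mulN1r -zsumZ -zsumD.
under eq_zsum do rewrite mulN1r.
by rewrite zsum_telescope f0 f1 subrr.
Qed.

Lemma zsum_single L (f : int -> R) : (forall j, j != 0 -> f j = 0) ->
  zsum L f = f 0.
Proof.
move=> f0; rewrite /zsum big_mkord.
have ltL : (L < L.*2.+1)%N by lia.
rewrite (bigD1 (Ordinal ltL)) //= subrr big1 ?addr0 // => i.
rewrite -val_eqE /= => neqi; rewrite f0 //; lia.
Qed.

End IntSum.


(** The product j(5j+1) is nonnegative and even, so neither the absolute value nor the division
    loses anything. *)
Definition pent (j : int) : nat := (`|(j * (5 * j + 1))%R| %/ 2)%N.

Lemma pentE (j : int) : (pent j)%:Z * 2 = j * (5 * j + 1).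
Proof.
rewrite /pent.
have [k [->|->]] : exists k : int, j = 2 * k \/ j = 2 * k + 1.
  by exists (j %/ 2)%Z; lia.
have -> : 2 * k * (5 * (2 * k) + 1) = (k * (10 * k + 1)) * 2 by ring.
  rewrite abszM mulnK //; have : 0 <= k * (10 * k + 1).
    by case: (leP 0 k) => ?; nia.
  by move: (k * _) => t; lia.
have -> : (2 * k + 1) * (5 * (2 * k + 1) + 1) =
    ((2 * k + 1) * (5 * k + 3)) * 2 by ring.
rewrite abszM mulnK //; have : 0 <= (2 * k + 1) * (5 * k + 3).
  by case: (leP 0 k) => ?; nia.
by move: (_ * (5 * k + 3)) => t; lia.
Qed.

(** Once [q ^+ r.+1 = 0], this bound kills the theta terms with |j| > r. *)
Lemma pent_ge (j : int) : (`|j| <= pent j)%N.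
Proof. have := pentE j; nia. Qed.

(** * Schur polynomials and the finite triple product *)

Section Schur.
Variables (R : comNzRingType) (q : R).

Definition psign (j : int) : R := (-1) ^+ `|j|.

Lemma psignD1 (j : int) : psign (j + 1) = - psign j.
Proof.
rewrite /psign -signr_odd -[in RHS]signr_odd.
have -> : odd `|(j + 1)%R| = ~~ odd `|j| by lia.
by case: odd; rewrite /= ?expr0 ?expr1 ?opprK.
Qed.

(* The MacMahon-Schur finite form of the theta series; it does not depend on
   the cut-off L once L >= N. *)
Definition schur (L N : nat) : R :=
  zsum L (fun j => psign j * q ^+ pent j * qbinz q N ((N%:Z - 5 * j) %/ 2)%Z).

Lemma schur0 L : schur L 0 = 1.
Proof.
rewrite /schur zsum_single; first by rewrite /psign /= !mul1r.
by move=> j j0; rewrite qbinz_out ?mulr0 //; lia.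
Qed.

Lemma schur1 L : schur L 1 = 1.
Proof.
rewrite /schur zsum_single; first by rewrite /psign /= !mul1r.
by move=> j j0; rewrite qbinz_out ?mulr0 //; lia.
Qed.

(* By the two Pascal rules, the defect of the recurrence at j is a single term:
   it is [schur_cert N j] if N - 5 j is even, and - [schur_cert N (j + 1)] if it
   is odd. *)
Definition schur_cert N (j : int) : R :=
  let m := ((N.+2%:Z - 5 * j) %/ 2)%Z in
  if 2 * m == N.+2%:Z - 5 * j
  then psign j * (q ^+ (pent j + `|m|) * qbinz q N m) else 0.

Lemma schur_step N (j : int) :
  psign j * q ^+ pent j * qbinz q N.+2 ((N.+2%:Z - 5 * j) %/ 2)%Z
  - psign j * q ^+ pent j * qbinz q N.+1 ((N.+1%:Z - 5 * j) %/ 2)%Z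
  - q ^+ N.+1 * (psign j * q ^+ pent j * qbinz q N ((N%:Z - 5 * j) %/ 2)%Z)
  = schur_cert N j - schur_cert N (j + 1).
Proof.
rewrite /schur_cert /=.
case: ifPn => Ej; case: ifPn => Ej1; first by lia.
- set m := (_ %/ 2)%Z in Ej *.
  have -> : ((N.+1%:Z - 5 * j) %/ 2)%Z = m - 1 by lia.
  have -> : ((N%:Z - 5 * j) %/ 2)%Z = m - 1 by lia.
  (* The first Pascal rule cancels the [N.+1] term, then the second cancels the [q ^+ N.+1] term, as
     m + (N+1-m) = N+1. What remains is q^m [N; m]. *)
  rewrite (qbinzS q N.+1) (qbinzS' q N m) mulrDr mulrDr mulrA -!exprD.
  rewrite (@qbinz_exp _ _ _ N (m - 1) _ N.+1); last by lia.
  by rewrite exprD; ring.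
- set m := (_ %/ 2)%Z in Ej Ej1 *.
  set m1 := (_ %/ 2)%Z in Ej1 *.
  have -> : ((N.+1%:Z - 5 * j) %/ 2)%Z = m by lia.
  have -> : ((N%:Z - 5 * j) %/ 2)%Z = m - 1 by lia.
  have -> : m1 = m - 2 by lia.
  (* For the other parity the two Pascal rules are used in the opposite order, leaving q^(N+2-m)
     [N; m-2]. *)
  rewrite (qbinzS' q N.+1) (qbinzS q N (m - 1)) mulrDr mulrDr.
  rewrite (mulrA (q ^+ _)) -!exprD.
  rewrite (@qbinz_exp _ _ _ N (m - 1) _ N.+1); last by lia.
  rewrite psignD1.
  have -> : m - 1 - 1 = m - 2 by lia.
  rewrite (@qbinz_exp _ _ _ N (m - 2) (pent (j + 1) + _)
    (pent j + `|N.+2%:Z - m|)).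
    by rewrite exprD; ring.
  (* The exponents match because [pent (j + 1)] exceeds [pent j] by 5j+3, and 2m = N+1-5j here. *)
  have := pentE j; have := pentE (j + 1). 
  move: (pent j) (pent (j + 1)) => a b.
  have -> : (j + 1) * (5 * (j + 1) + 1) = j * (5 * j + 1) + 10 * j + 6 by ring.
  lia.
- lia.
Qed.

Lemma schurS L N : (N <= L)%N ->
  schur L N.+2 = schur L N.+1 + q ^+ N.+1 * schur L N.
Proof.
move=> leNL; rewrite /schur -zsumZ -zsumD -[RHS]addr0.
have <- : zsum L (fun j => schur_cert N j - schur_cert N (j + 1)) = 0.
  (* At j = -L the lower index exceeds [N], and at j = L+1 it is negative, so both boundary terms
     vanish. *)
  rewrite zsum_telescope /schur_cert !qbinz_out; try lia.
  by rewrite !mulr0 !if_same subrr.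
by rewrite -zsumD; apply: eq_zsum => j; rewrite -schur_step; ring.
Qed.

(* A finite form of the sum side of Jacobi's triple product. *)
Definition theta (L m : nat) : R :=
  zsum L (fun j => psign j * q ^+ pent j * qbinz (q ^+ 5) m.*2 (m%:Z + j)).

Lemma theta0 L : theta L 0 = 1.
Proof.
rewrite /theta zsum_single; first by rewrite /psign /= !mul1r.
by move=> j j0; rewrite qbinz_out ?mulr0 //; lia.
Qed.

(** Two Pascal steps express the summand for [m.+1] through the summands [u] for [m] at [j - 1], [j]
    and [j + 1]; shifting the index then makes all three sums equal. *)
Lemma thetaS L m : (m < L)%N ->
  theta L m.+1 = (1 - q ^+ (5 * m + 2)) * (1 - q ^+ (5 * m + 3)) * theta L m.
Proof.
move=> ltmL.
pose u (j : int) := psign j * q ^+ pent j * qbinz (q ^+ 5) m.*2 (m%:Z + j).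
have u_out (j : int) : (L <= `|j|)%N -> u j = 0.
  by move=> ?; rewrite /u qbinz_out ?mulr0 //; lia.
have step (j : int) :
    psign j * q ^+ pent j * qbinz (q ^+ 5) m.+1.*2 (m.+1%:Z + j) =
    (1 + q ^+ (5 * m + 2) * q ^+ (5 * m + 3)) * u j
    + (- q ^+ (5 * m + 3)) * u (j - 1) + (- q ^+ (5 * m + 2)) * u (j + 1).
  rewrite /u doubleS (qbinzS _ m.*2.+1) !(qbinzS' _ m.*2).
  have -> : m.+1%:Z + j - 1 = m%:Z + j by lia.
  have -> : m.+1%:Z + j = m%:Z + (j + 1) by lia.
  have -> : m%:Z + j - 1 = m%:Z + (j - 1) by lia.
  have -> : psign (j - 1) = - psign j.
    by rewrite -[in RHS](subrK 1 j) psignD1 opprK.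
  rewrite psignD1.
  have pj := pentE j; have := pentE (j - 1); have := pentE (j + 1).
  have -> : (j + 1) * (5 * (j + 1) + 1) = j * (5 * j + 1) + 10 * j + 6 by ring.
  have -> : (j - 1) * (5 * (j - 1) + 1) = j * (5 * j + 1) - 10 * j + 4 by ring.
  rewrite -pj; move: (pent j) (pent (j + 1)) (pent (j - 1)) => a b c Eb Ec.
  rewrite !mulrDr !(mulrA (_ ^+ _) (_ ^+ _)) -!exprM -!exprD.
  set X := absz (_ - (m%:Z + j))%R.
  set Y := absz (m%:Z + (j + 1))%R.
  set Z := absz (_ - _)%R.
  set B0 := qbinz _ _ (m%:Z + j).
  set B1 := qbinz _ _ (_ + (j - 1)).
  set B2 := qbinz _ _ (_ + (j + 1)).
  transitivity (psign j * (q ^+ (a + 5 * X) * B1 + q ^+ a * B0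
     + q ^+ (5 * Y + 5 * Z) * B0 * q ^+ a + q ^+ (a + 5 * Y) * B2)).
    by rewrite !(exprD q a); ring.
  (* The three exponent identities use pent(j+1) - pent(j) = 5j+3 and pent(j-1) - pent(j) = 2-5j. *)
  have -> : q ^+ (a + 5 * X) * B1 = q ^+ (5 * m + 3 + c) * B1.
    by apply: qbinz_exp; lia.
  have -> : q ^+ (5 * Y + 5 * Z) * B0 = q ^+ (5 * m + 2 + (5 * m + 3)) * B0.
    by apply: qbinz_exp; lia.
  have -> : q ^+ (a + 5 * Y) * B2 = q ^+ (5 * m + 2 + b) * B2.
    by apply: qbinz_exp; lia.
  by rewrite !exprD; ring.
rewrite /theta (eq_zsum _ step) !zsumD !zsumZ.
have -> : zsum L (fun j => u (j + 1)) = zsum L u.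
  by apply: zsum_shift; apply: u_out; lia.
have <- : zsum L u = zsum L (fun j => u (j - 1)).
  rewrite -[RHS]zsum_shift; try by apply: u_out; lia.
  by apply: eq_zsum => j; rewrite addrK.
(* With x and y the two powers of [q], the coefficients add up to 1 + xy - y - x = (1-x)(1-y). *)
by rewrite -/u; ring.
Qed.

End Schur.

(* Power series are handled modulo q^(r+1): with q nilpotent, limits become
   equalities. *)
Section Truncated.
Variables (R : comNzRingType) (q : R) (r : nat).
Hypothesis q_nil : q ^+ r.+1 = 0.

Lemma nil_expr k : (r < k)%N -> q ^+ k = 0.
Proof. by move=> ltrk; rewrite -(subnKC ltrk) exprD q_nil mul0r. Qed.

Lemma qfact_stable k : (r <= k)%N -> qfact q k = qfact q r.
Proof.
move/subnKC <-; elim: (k - r)%N => [|n IHn]; first by rewrite addn0.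
by rewrite addnS qfactS IHn nil_expr ?subr0 ?mulr1 // ltnS leq_addr.
Qed.

(** The inverse is the geometric series, finite because [q] is nilpotent. *)
Lemma one_sub_inv a : (0 < a)%N -> exists v, (1 - q ^+ a) * v = 1.
Proof.
move=> a_gt0; exists (\sum_(i < r.+1) (q ^+ a) ^+ i).
have -> : 1 - q ^+ a = - (q ^+ a - 1) by rewrite opprB.
rewrite mulNr -subrX1 -exprM nil_expr ?sub0r ?opprK //.
by rewrite mulnC leq_pmulr.
Qed.

Lemma prod_inv (I : Type) (s : seq I) (F : I -> R) :
  (forall i, exists v, F i * v = 1) -> exists v, (\prod_(i <- s) F i) * v = 1.
Proof.
move=> invF; apply: (big_ind (fun x => exists v, x * v = 1)) => //.
  by exists 1; rewrite mulr1.
move=> x y [v xv] [w yw]; exists (v * w).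
by rewrite mulrACA xv yw mulr1.
Qed.

Lemma qfact_inv n : exists v, qfact q n * v = 1.
Proof. by apply: prod_inv => i; apply: one_sub_inv. Qed.

(** All three factorials in [qbin_fact] have stabilised to [qfact q r], and one invertible copy
    cancels. *)
Lemma qbin_stable n k :
  (r <= k)%N -> (k + r <= n)%N -> qbin q n k * qfact q r = 1.
Proof.
move=> lerk lekn; have [v fv] := qfact_inv r.
have := @qbin_fact R q n k; rewrite !qfact_stable; try lia.
move=> /(_ ltac:(lia)) /(congr1 ( *%R^~ v)).
by rewrite -!mulrA fv mulr1.
Qed.

End Truncated.

(** * Stable limits and the product formula *)

Section RogersRamanujan.
Variables (R : comNzRingType) (q : R) (r : nat).
Hypothesis q_nil : q ^+ r.+1 = 0.

Let q5_nil : (q ^+ 5) ^+ r.+1 = 0.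
Proof. by rewrite exprAC q_nil expr0n. Qed.

(** Terms with |j| > r vanish. For the others, the lower index lies between about (N-5r)/2 and
    (N+5r)/2, and it must be at least r and at most N-r: hence the bound 7r. *)
Lemma schur_limit L N : (7 * r < N)%N ->
  schur q L N * qfact q r = zsum L (fun j => psign R j * q ^+ pent j).
Proof.
move=> ltrN; rewrite mulrC /schur -zsumZ; apply: eq_zsum => j.
have [lt_r|le_r] := ltnP r `|j|.
  by rewrite (nil_expr q_nil (leq_trans lt_r (pent_ge j))) !(mulr0, mul0r).
have [k -> [lerk lekN]] :
    exists2 k : nat, ((N%:Z - 5 * j) %/ 2)%Z = k & (r <= k /\ k + r <= N)%N.
  by exists `|((N%:Z - 5 * j) %/ 2)%Z|%N; lia.
by rewrite mulrCA [qfact _ _ * _]mulrC /= (qbin_stable q_nil) ?mulr1.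
Qed.

(** For |j| <= r the lower index m+j must be at least r and at most 2m-r: hence the bound 2r. *)
Lemma theta_limit L m : (2 * r <= m)%N ->
  theta q L m * qfact (q ^+ 5) r = zsum L (fun j => psign R j * q ^+ pent j).
Proof.
move=> lerm; rewrite mulrC /theta -zsumZ; apply: eq_zsum => j.
have [lt_r|le_r] := ltnP r `|j|.
  by rewrite (nil_expr q_nil (leq_trans lt_r (pent_ge j))) !(mulr0, mul0r).
have [k -> [lerk lekm]] :
    exists2 k : nat, m%:Z + j = k & (r <= k /\ k + r <= m.*2)%N.
  by exists (absz (m%:Z + j)%R); lia.
by rewrite mulrCA [qfact _ _ * _]mulrC /= (qbin_stable q5_nil) ?mulr1.
Qed.

Lemma theta_prod L m : (m <= L)%N ->
  theta q L m = \prod_(k < m) ((1 - q ^+ (5 * k + 2)) * (1 - q ^+ (5 * k + 3))).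
Proof.
elim: m => [|m IHm] lemL; first by rewrite theta0 big_ord0.
by rewrite thetaS // IHm 1?ltnW // big_ord_recr mulrC.
Qed.

Lemma qfact_mod5 m : qfact q (5 * m) =
  \prod_(k < m) ((1 - q ^+ (5 * k + 1)) * (1 - q ^+ (5 * k + 4)))
  * (\prod_(k < m) ((1 - q ^+ (5 * k + 2)) * (1 - q ^+ (5 * k + 3)))
     * qfact (q ^+ 5) m).
Proof.
elim: m => [|m IHm]; first by rewrite /qfact !big_ord0 !mulr1.
have -> : (5 * m.+1 = (5 * m).+4.+1)%N by lia.
rewrite !big_ord_recr !qfactS IHm /= -exprM !addnS !addn0.
have -> : (5 * m.+1 = (5 * m).+4.+1)%N by lia.
by ring.
Qed.

(** Both limits are the same theta series. Splitting [qfact q (5 * m)] by residues and cancelling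
    the invertible factors for residues 2, 3 and 0 leaves residues 1 and 4. *)
Lemma schur_prod L N m : (7 * r < N)%N -> (2 * r <= m <= L)%N ->
  schur q L N * \prod_(k < m) ((1 - q ^+ (5 * k + 1)) * (1 - q ^+ (5 * k + 4)))
  = 1.
Proof.
move=> ltrN /andP[lerm lemL].
have := schur_limit L ltrN; rewrite -(theta_limit L lerm) theta_prod //.
rewrite -(@qfact_stable _ _ _ q_nil (5 * m)) ?qfact_mod5; last by lia.
rewrite (@qfact_stable _ _ _ q5_nil m); last by lia.
have [v] := qfact_inv q5_nil r.
have [w] : exists w,
    \prod_(k < m) ((1 - q ^+ (5 * k + 2)) * (1 - q ^+ (5 * k + 3))) * w = 1.
  apply: prod_inv => k; have [|x Ex] := @one_sub_inv _ _ _ q_nil (5 * k + 2).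
    by rewrite addn2.
  have [|y Ey] := @one_sub_inv _ _ _ q_nil (5 * k + 3); first by rewrite addn3.
  by exists (x * y); rewrite mulrACA Ex Ey mulr1.
move: (\prod_(k < m) _) (\prod_(k < m) _) => S F Fw Pv.
move/(congr1 ( *%R^~ (w * v))).
have FPwv : F * qfact (q ^+ 5) r * (w * v) = 1 by rewrite mulrACA Fw Pv mulr1.
by rewrite FPwv -(mulrA (schur q L N)) -(mulrA S) FPwv mulr1.
Qed.

End RogersRamanujan.

(** * Truncated generating functions *)

Section GeneratingFunction.
Variables (R : comNzRingType) (q : R) (r : nat).
Hypothesis q_nil : q ^+ r.+1 = 0.

Definition gf (f : nat -> nat) : R := \sum_(0 <= n < r.+1) (f n)%:R * q ^+ n.

Lemma eq_gf f g : f =1 g -> gf f = gf g.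
Proof. by move=> fg; apply: eq_bigr => n _; rewrite fg. Qed.

Lemma gfD f g : gf (fun n => f n + g n)%N = gf f + gf g.
Proof.
by rewrite /gf -big_split; apply: eq_bigr => n _; rewrite natrD mulrDl.
Qed.

Lemma gf_shift a f :
  gf (fun n => if (a <= n)%N then f (n - a)%N else 0%N) = q ^+ a * gf f.
Proof.
elim: a f => [|a IHa] f.
  by rewrite expr0 mul1r; apply: eq_gf => n; rewrite subn0.
transitivity (q * gf (fun n => if (a <= n)%N then f (n - a)%N else 0%N)).
  rewrite /gf big_nat_recl // mul0r add0r big_nat_recr //= mulrDr.
  (* The top term is pushed to degree r+1, where it vanishes. *)
  rewrite [X in _ + X]mulrCA -exprS q_nil !mulr0 addr0 mulr_sumr.
  by apply: eq_bigr => n _; rewrite ltnS subSS mulrCA -exprS.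
by rewrite IHa exprS mulrA.
Qed.

End GeneratingFunction.

(** Taking for [q] the class of X in Z[X]/(X^(r+1)), the series are represented by polynomials of
    degree at most r, whose coefficients can be read off. *)
Lemma gf_inj (r : nat) (f g : nat -> nat) :
  (forall (R : comNzRingType) (q : R), q ^+ r.+1 = 0 -> gf q r f = gf q r g) ->
  f r = g r.
Proof.
pose h : {poly int} := 'X^(r.+1); pose q := in_qpoly h 'X.
have mk_h : mk_monic h = h by exact: mk_monic_Xn.
have q_nil : q ^+ r.+1 = 0.
  rewrite -rmorphXn; apply: val_inj => /=.
  by rewrite mk_h Pdiv.RingMonic.rmodpp ?monicXn.
have gfE u : gf q r u = in_qpoly h (\poly_(n < r.+1) (u n)%:R).
  rewrite /gf big_mkord poly_def raddf_sum; apply: eq_bigr => n _ /=.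
  by rewrite scaler_nat raddfMn /= rmorphXn mulr_natl.
move/(_ _ q q_nil); rewrite !gfE => /(congr1 val).
have sz u :
    (size (\poly_(n < r.+1) (u n)%:R : {poly int}) < size (mk_monic h))%N.
  by rewrite mk_h size_polyXn ltnS size_poly.
rewrite /= !Pdiv.CommonRing.rmodp_small // => /polyP/(_ r).
by rewrite !coef_poly ltnSn => /eqP; rewrite eqr_nat => /eqP.
Qed.

(** * The first Rogers-Ramanujan identity *)

Section PartitionGF.
Variables (R : comNzRingType) (q : R) (r : nat).
Hypothesis q_nil : q ^+ r.+1 = 0.

Lemma gf_delta0 : gf q r (fun n => n == 0%N) = 1.
Proof.
by rewrite /gf big_nat_recl // mul1r big1 ?addr0 // => n _; rewrite mul0r.
Qed.

Lemma gf_nsd_lt L N : (N <= L)%N -> gf q r (nsd_lt N) = schur q L N.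
Proof.
elim/ltn_ind: N => -[|[|N]] IHN leNL.
- rewrite schur0 -gf_delta0; apply: eq_gf => n; exact: npart_lt1.
- rewrite schur1 -gf_delta0; apply: eq_gf => n; exact: npart_lt1.
rewrite schurS; last by lia.
rewrite -(IHN N.+1) -?(IHN N); try lia.
rewrite -(gf_shift q_nil) -gfD.
by apply: eq_gf => n; rewrite nsd_lt_rec.
Qed.

(** Allowing the part [N] any number of times divides by 1-q^N; the boolean multiple turns this
    factor into 1 when [N] is not an admissible part. *)
Lemma gf_npm1_ltS N : (0 < N)%N ->
  gf q r (npm1_lt N) = gf q r (npm1_lt N.+1) * (1 - q ^+ N *+ pm1_mod5 N).
Proof.
move=> N_gt0; apply/eqP; rewrite mulrBr mulr1 -subr_eq opprK eq_sym; apply/eqP.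
rewrite [LHS](eq_gf _ _ (fun n => npm1_lt_rec n N_gt0)) gfD; congr (_ + _).
case: (pm1_mod5 N) => /=; first by rewrite mulr1n mulrC -gf_shift.
by rewrite mulr0n mulr0 /gf big1 // => n _; rewrite mul0r.
Qed.

Lemma gf_npm1_lt m : gf q r (npm1_lt (5 * m).+1) *
  \prod_(k < m) ((1 - q ^+ (5 * k + 1)) * (1 - q ^+ (5 * k + 4))) = 1.
Proof.
elim: m => [|m IHm].
  by rewrite big_ord0 mulr1 -gf_delta0; apply: eq_gf => n; apply: npart_lt1.
rewrite big_ord_recr /= mulrA -[RHS]IHm.
have step i : gf q r (npm1_lt (5 * m + i).+1) =
    gf q r (npm1_lt (5 * m + i.+1).+1)
    * (1 - q ^+ (5 * m + i.+1) *+ pm1_mod5 i.+1).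
  by rewrite gf_npm1_ltS // addnS /pm1_mod5 -addnS mulnC !modnMDl.
have step0 := step 0%N; rewrite addn0 in step0.
have -> : (5 * m.+1 = 5 * m + 5)%N by lia.
(* Among the five successive bounds only residues 1 and 4 contribute a factor. *)
by rewrite step0 !(step 1, step 2, step 3, step 4)%N /= !mulr1n !mulr0n; ring.
Qed.

End PartitionGF.

Theorem rogers_ramanujan r : npm1 r = nsd r.
Proof.
(* These are the thresholds of [schur_prod]; both part bounds, [N] and 10r+1, exceed [r], so they do
   not restrict partitions of [r]. *)
pose N := (7 * r).+1; pose m := (2 * r)%N.
transitivity (npm1_lt (5 * m).+1 r).
  apply: eq_in_npart => s sP; rewrite (@all_lt_part r) ?andbT //; lia.
transitivity (nsd_lt N r); last first.
  apply: eq_in_npart => s sP; rewrite (@all_lt_part r) ?andbT //; lia.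
apply: gf_inj => R q q_nil; rewrite (gf_nsd_lt q_nil (leqnn N)).
have E1 := gf_npm1_lt q_nil m.
have E2 : schur q N N *
    \prod_(k < m) ((1 - q ^+ (5 * k + 1)) * (1 - q ^+ (5 * k + 4))) = 1.
  by apply: (schur_prod q_nil); lia.
(* Both sides are inverses of the same product, hence equal. *)
by rewrite -[LHS]mulr1 -E2 mulrCA E1 mulr1.
Qed.

Theorem theorem1 (n : nat) :
  (A n)%:Z - (B n)%:Z = (#|pair_set n|)%:Z.
Proof.
suff -> : A n = (#|pair_set n| + B n)%N by rewrite PoszD addrK.
rewrite A_sum card_pair_set B_sum.
(* For n = 0 all sums are empty; otherwise the index a = 1 exists and can be split off. *)
case: n => [|n]; first by rewrite !big1 // => -[[]].
have lt1 : (1 < n.+2)%N by [].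
rewrite (bigD1 (Ordinal lt1)) //= [in RHS](bigD1 (Ordinal lt1)) //= addnAC.
congr addn; last first.
  apply: eq_bigr => a /andP[_ a_neq1]; apply: eq_bigr => b _.
  case: ifP => // _; rewrite rogers_ramanujan; apply: eq_in_npart => s _.
  by rewrite -val_eqE /= in a_neq1; rewrite (negPf a_neq1) andbT.
(* For a = 1, the super-distinct partitions [near] to [b] belong to the pairs, and the remaining
   ones to [B]. *)
rewrite -big_split; apply: eq_bigr => b _ /=.
rewrite mul1n -ltnS ltn_ord rogers_ramanujan addnC.
exact: npart_split.
Qed.
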